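(* Let $X$ be any infinite set. Then $\mathcal P_X$ has the semigroup Bergman property: for every subset $A\subseteq\mathcal P_X$ that generates $\mathcal P_X$ as a semigroup, there is a natural number $N$ (depending on $A$) such that every element of $\mathcal P_X$ is a product of at most $N$ elements of $A$.
   Context: Partition monoid: let $X'=\{x':x\in X\}$ be a disjoint copy of the set $X$. The elements of $\mathcal P_X$ are all set partitions $\alpha$ of $X\cup X'$ into nonempty blocks. Product: given $\alpha,\beta\in\mathcal P_X$, let $X''=\{x'':x\in X\}$ be a third disjoint copy of $X$; relabel each lower vertex $x'$ of (a graph whose connected components are the blocks of) $\alpha$ as $x''$, relabel each upper vertex $x$ of (a graph representing) $\beta$ as $x''$, and take the union of the two graphs on vertex set $X\cup X''\cup X'$. Then $\alpha\beta\in\mathcal P_X$ is the partition in which $u,v\in X\cup X'$ lie in the same block if and only if they are joined by a (finite) path in this graph. This makes $\mathcal P_X$ a monoid with identity $\{\{x,x'\}:x\in X\}$. A semigroup $S$ has the semigroup Bergman property if the length function of $S$ is bounded with respect to any generating set for $S$ (the bound may depend on the generating set). *)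

(* Defs.v *)
From HB Require Import structures.
From Stdlib Require Import Relation_Operators Operators_Properties.
From mathcomp Require Import all_boot.
From mathcomp Require Import boolp classical_sets functions cardinality.

Set Implicit Arguments.
Unset Strict Implicit.
Unset Printing Implicit Defensive.

Local Open Scope classical_set_scope.

(* [Upper x] is x in X and [Lower x] is x' in X'. *)
Inductive vertex (X : Type) := Upper of X | Lower of X.

Record ptn (X : Type) := Ptn {
  blocks : set (set (vertex X));
  blocksP : partition blocks id [set: vertex X] }.

HB.instance Definition _ X := gen_eqMixin (ptn X).
HB.instance Definition _ X := gen_choiceMixin (ptn X).

Section PartitionsAndEquivalences.
Variable X : Type.
Implicit Types (a b : ptn X) (u v w : vertex X) (R : vertex X -> vertex X -> Prop).

Definition same_block a u v := exists2 B, blocks a B & B u /\ B v.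

Lemma blocks_uniq a B C u : blocks a B -> blocks a C -> B u -> C u -> B = C.
Proof.
by case: (blocksP a) => _ tr _ aB aC Bu Cu; apply: tr => //; exists u.
Qed.

Lemma same_block_refl a u : same_block a u u.
Proof.
case: (blocksP a) => cov _ _; have : [set: vertex X] u by [].
by rewrite -cov => -[B aB Bu]; exists B.
Qed.

Lemma same_block_sym a u v : same_block a u v -> same_block a v u.
Proof. by case=> B aB [Bu Bv]; exists B. Qed.

Lemma same_block_trans a u v w :
  same_block a u v -> same_block a v w -> same_block a u w.
Proof.
case=> B aB [Bu Bv] [C aC [Cv Cw]]; exists B => //; split=> //.
by rewrite (blocks_uniq aB aC Bv Cv).
Qed.

Lemma ptn_eq a b : (forall u v, same_block a u v <-> same_block b u v) -> a = b.
Proof.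
move=> ab.
have sub c d : (forall u v, same_block c u v <-> same_block d u v) ->
    blocks c `<=` blocks d.
  move=> cd B cB; have [_ _ ne] := blocksP c; have [u Bu] := ne _ cB.
  have [C dC [Cu _]] := same_block_refl d u.
  suff -> : B = C by [].
  apply/seteqP; split=> v.
    move=> Bv; have [|D dD [Du Dv]] := (cd u v).1; first by exists B.
    by rewrite (blocks_uniq dC dD Cu Du).
  move=> Cv; have [|D cD [Du Dv]] := (cd u v).2; first by exists C.
  by rewrite (blocks_uniq cB cD Bu Du).
have eqb : blocks a = blocks b.
  by apply/seteqP; split; apply: sub => // u v; rewrite ab.
case: a b eqb {ab} => [B Bp] [C Cp] /= eqb.
by case: _ / eqb Cp => Cp; rewrite (Prop_irrelevance Bp Cp).
Qed.

Definition classes R : set (set (vertex X)) := range (fun u => [set v | R u v]).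

Lemma classesP R :
  (forall u, R u u) -> (forall u v, R u v -> R v u) ->
  (forall u v w, R u v -> R v w -> R u w) ->
  partition (classes R) id [set: vertex X].
Proof.
move=> Rr Rs Rt; split.
- by apply/seteqP; split=> // u _; exists [set v | R u v] => //; exists u.
- move=> _ _ [u _ <-] [v _ <-] [w [/= uw vw]].
  by apply/seteqP; split=> z /= h;
    [apply: Rt (Rt _ _ _ vw (Rs _ _ uw)) h|apply: Rt (Rt _ _ _ uw (Rs _ _ vw)) h].
- by move=> _ [u _ <-]; exists u => /=.
Qed.

Lemma same_block_classes a R :
  (forall u, R u u) -> (forall u v, R u v -> R v u) ->
  (forall u v w, R u v -> R v w -> R u w) ->
  blocks a = classes R -> forall u v, same_block a u v <-> R u v.
Proof.
move=> Rr Rs Rt aR u v; split.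
  case=> B; rewrite aR => -[w _ <-] [/= wu wv].
  exact: Rt (Rs _ _ wu) wv.
by move=> uv; exists [set w | R u w]; [rewrite aR; exists u|split=> /=].
Qed.

End PartitionsAndEquivalences.

(* The three rows X, X'' and X' of the graph defining the product. *)
Inductive pvertex (X : Type) := Top of X | Mid of X | Bot of X.

Section Product.
Variable X : Type.
Implicit Types (a b c : ptn X) (u v w : vertex X) (p q r : pvertex X).

Definition top_mid u := match u with Upper x => Top x | Lower x => Mid x end.
Definition mid_bot u := match u with Upper x => Mid x | Lower x => Bot x end.
Definition top_bot u := match u with Upper x => Top x | Lower x => Bot x end.

(* Each partition is represented by the graph that is complete on every
   block; the product depends only on the connected components. *)
Inductive edge a b : pvertex X -> pvertex X -> Prop :=
| EdgeTop u v : same_block a u v -> edge a b (top_mid u) (top_mid v)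
| EdgeBot u v : same_block b u v -> edge a b (mid_bot u) (mid_bot v).

(* [edge] is symmetric, so this is the existence of a finite path. *)
Definition joined a b := clos_refl_trans (pvertex X) (edge a b).

Lemma joined_refl a b p : joined a b p p.
Proof. exact: rt_refl. Qed.

Lemma joined_trans a b q p r : joined a b p q -> joined a b q r -> joined a b p r.
Proof. exact: rt_trans. Qed.

Lemma joined_edge a b p q : edge a b p q -> joined a b p q.
Proof. exact: rt_step. Qed.

Lemma joined_sym a b p q : joined a b p q -> joined a b q p.
Proof.
elim=> {p q} [p q [u v|u v] /same_block_sym uv|p|p q r _ pq _ qr].
- exact/joined_edge/EdgeTop.
- exact/joined_edge/EdgeBot.
- exact: joined_refl.
- exact: joined_trans qr pq.
Qed.

Definition prod_rel a b u v := joined a b (top_bot u) (top_bot v).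

Lemma prod_relP a b : partition (classes (prod_rel a b)) id [set: vertex X].
Proof.
apply: classesP => [u|u v|u v w]; first exact: joined_refl.
- exact: joined_sym.
- exact: joined_trans.
Qed.

Definition mul_ptn a b : ptn X := Ptn (prod_relP a b).

Definition one_blocks : set (set (vertex X)) :=
  range (fun x => [set Upper x; Lower x]).

Lemma one_blocksP : partition one_blocks id [set: vertex X].
Proof.
split.
- apply/seteqP; split=> // -[] x _; exists [set Upper x; Lower x];
    by [exists x|left|right].
- move=> _ _ [x _ <-] [y _ <-] [[z|z] [/= [|] // [->] [|] // [->]]] //.
- by move=> _ [x _ <-]; exists (Upper x); left.
Qed.

Definition one_ptn : ptn X := Ptn one_blocksP.

Lemma same_block_mul a b u v :
  same_block (mul_ptn a b) u v <-> joined a b (top_bot u) (top_bot v).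
Proof.
apply: (@same_block_classes _ _ (prod_rel a b)) => //.
- by move=> w; exact: joined_refl.
- by move=> w z; exact: joined_sym.
- by move=> w z t; exact: joined_trans.
Qed.

Definition col u := match u with Upper x => x | Lower x => x end.

Lemma same_block_one u v : same_block one_ptn u v <-> col u = col v.
Proof.
split; first by case=> _ [x _ <-] [/= [->|->] [->|->]].
move=> uv; exists [set Upper (col u); Lower (col u)]; first by exists (col u).
by split; [case: {uv}u => x|rewrite uv; case: {uv}v => x]; [left|right|left|right].
Qed.

Lemma mul1_ptn : left_id one_ptn mul_ptn.
Proof.
move=> a; apply: ptn_eq => u v; rewrite same_block_mul; split.
  pose f p := match p with Top x => Upper x | Mid x => Upper x | Bot x => Lower x end.
  have fj p q : joined one_ptn a p q -> same_block a (f p) (f q).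
    elim=> {p q} [p q [w z /same_block_one|w z]|p|p q r _ pq _ qr].
    - by case: w => x; case: z => y /= ->; exact: same_block_refl.
    - by case: w => x; case: z => y.
    - exact: same_block_refl.
    - exact: same_block_trans pq qr.
  by move/fj; case: u => x; case: v => y.
have j w : joined one_ptn a (top_bot w) (mid_bot w).
  case: w => x /=; last exact: joined_refl.
  by apply/joined_edge/(@EdgeTop _ _ (Upper x) (Lower x))/same_block_one.
move=> uv; apply: joined_trans (j u) (joined_trans _ (joined_sym (j v))).
exact/joined_edge/EdgeBot.
Qed.

Lemma mulp1_ptn : right_id one_ptn mul_ptn.
Proof.
move=> a; apply: ptn_eq => u v; rewrite same_block_mul; split.
  pose f p := match p with Top x => Upper x | Mid x => Lower x | Bot x => Lower x end.
  have fj p q : joined a one_ptn p q -> same_block a (f p) (f q).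
    elim=> {p q} [p q [w z|w z /same_block_one]|p|p q r _ pq _ qr].
    - by case: w => x; case: z => y.
    - by case: w => x; case: z => y /= ->; exact: same_block_refl.
    - exact: same_block_refl.
    - exact: same_block_trans pq qr.
  by move/fj; case: u => x; case: v => y.
have j w : joined a one_ptn (top_bot w) (top_mid w).
  case: w => x /=; first exact: joined_refl.
  by apply/joined_edge/(@EdgeBot _ _ (Lower x) (Upper x))/same_block_one.
move=> uv; apply: joined_trans (j u) (joined_trans _ (joined_sym (j v))).
exact/joined_edge/EdgeTop.
Qed.

(* For associativity, both triple products are compared with the four-row
   graph of a, b and c; a vertex is a row number in {0, 1, 2, 3} and a point. *)
Let row i u : nat * X :=
  match u with Upper x => (i, x) | Lower x => (i.+1, x) end.

Inductive edge4 a b c : nat * X -> nat * X -> Prop :=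
| Edge4a u v : same_block a u v -> edge4 a b c (row 0 u) (row 0 v)
| Edge4b u v : same_block b u v -> edge4 a b c (row 1 u) (row 1 v)
| Edge4c u v : same_block c u v -> edge4 a b c (row 2 u) (row 2 v).

Let joined4 a b c := clos_refl_trans (nat * X) (edge4 a b c).
Let ends u : nat * X := match u with Upper x => (0, x) | Lower x => (3, x) end.

Lemma mul_mulE_l a b c u v :
  same_block (mul_ptn (mul_ptn a b) c) u v <-> joined4 a b c (ends u) (ends v).
Proof.
rewrite same_block_mul; split.
  pose f p : nat * X := match p with Top x => (0, x) | Mid x => (1, x) | Bot x => (2, x) end.
  have fj p q : joined a b p q -> joined4 a b c (f p) (f q).
    elim=> {p q} [p q [w z wz|w z wz]|p|p q r _ pq _ qr].
    - by apply: rt_step; case: w z wz => x [] y wz; exact: (Edge4a b c wz).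
    - by apply: rt_step; case: w z wz => x [] y wz; exact: (Edge4b a c wz).
    - exact: rt_refl.
    - exact: rt_trans pq qr.
  pose g p : nat * X := match p with Top x => (0, x) | Mid x => (2, x) | Bot x => (3, x) end.
  have gj p q : joined (mul_ptn a b) c p q -> joined4 a b c (g p) (g q).
    elim=> {p q} [p q [w z /same_block_mul/fj wz|w z wz]|p|p q r _ pq _ qr].
    - by case: w z wz => x [] y.
    - by apply: rt_step; case: w z wz => x [] y wz; exact: (Edge4c a b wz).
    - exact: rt_refl.
    - exact: rt_trans pq qr.
  by move/gj; case: u => x; case: v => y.
pose p0 := top_bot u.
pose via m := exists2 w, joined (mul_ptn a b) c p0 (top_mid w)
                       & joined a b (top_bot w) m.
pose J (q : nat * X) := match q.1 with
  | 0 => via (Top q.2) | 1 => via (Mid q.2) | 2 => via (Bot q.2)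
  | _ => joined (mul_ptn a b) c p0 (Bot q.2) end.
have ext m m' : edge a b m m' -> via m -> via m'.
  by move=> e [w h1 h2]; exists w => //; apply: joined_trans h2 (joined_edge e).
have out w : via (top_bot w) -> joined (mul_ptn a b) c p0 (top_mid w).
  case=> z h1 h2; apply: joined_trans h1 _; apply/joined_edge/EdgeTop.
  exact/same_block_mul.
have inn w : joined (mul_ptn a b) c p0 (top_mid w) -> via (top_bot w).
  by move=> h; exists w => //; exact: joined_refl.
have outc w : J (row 2 w) -> joined (mul_ptn a b) c p0 (mid_bot w).
  by case: w => x //= h; apply: (out (Lower x)).
have inc w : joined (mul_ptn a b) c p0 (mid_bot w) -> J (row 2 w).
  by case: w => x //= h; apply: (inn (Lower x)).
have Ju : J (ends u).
  rewrite /J /p0; case: u @p0 @via @J {ext out inn outc inc} => x /=; last exact: joined_refl.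
  by exists (Upper x) => /=; exact: joined_refl.
have Jstep (q q' : nat * X) : edge4 a b c q q' -> J q -> J q'.
  case=> [w z wz|w z wz|w z wz].
  - by case: w z wz => x [] y wz; exact: (ext _ _ (EdgeTop b wz)).
  - by case: w z wz => x [] y wz; exact: (ext _ _ (EdgeBot a wz)).
  - move/outc=> h; apply: inc; apply: joined_trans h _.
    exact/joined_edge/EdgeBot.
have Jall (q q' : nat * X) : joined4 a b c q q' -> J q -> J q'.
  by elim=> {q q'} [q q' /Jstep|//|q q' q'' _ h _ h' /h /h'].
move/Jall/(_ Ju); case: v => y //= h.
exact: (out (Upper y)).
Qed.

Lemma mul_mulE_r a b c u v :
  same_block (mul_ptn a (mul_ptn b c)) u v <-> joined4 a b c (ends u) (ends v).
Proof.
rewrite same_block_mul; split.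
  pose f p : nat * X := match p with Top x => (1, x) | Mid x => (2, x) | Bot x => (3, x) end.
  have fj p q : joined b c p q -> joined4 a b c (f p) (f q).
    elim=> {p q} [p q [w z wz|w z wz]|p|p q r _ pq _ qr].
    - by apply: rt_step; case: w z wz => x [] y wz; exact: (Edge4b a c wz).
    - by apply: rt_step; case: w z wz => x [] y wz; exact: (Edge4c a b wz).
    - exact: rt_refl.
    - exact: rt_trans pq qr.
  pose g p : nat * X := match p with Top x => (0, x) | Mid x => (1, x) | Bot x => (3, x) end.
  have gj p q : joined a (mul_ptn b c) p q -> joined4 a b c (g p) (g q).
    elim=> {p q} [p q [w z wz|w z /same_block_mul/fj wz]|p|p q r _ pq _ qr].
    - by apply: rt_step; case: w z wz => x [] y wz; exact: (Edge4a b c wz).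
    - by case: w z wz => x [] y.
    - exact: rt_refl.
    - exact: rt_trans pq qr.
  by move/gj; case: u => x; case: v => y.
pose p0 := top_bot u.
pose via m := exists2 w, joined a (mul_ptn b c) p0 (mid_bot w)
                       & joined b c (top_bot w) m.
pose J (q : nat * X) := match q.1 with
  | 0 => joined a (mul_ptn b c) p0 (Top q.2)
  | 1 => via (Top q.2) | 2 => via (Mid q.2) | _ => via (Bot q.2) end.
have ext m m' : edge b c m m' -> via m -> via m'.
  by move=> e [w h1 h2]; exists w => //; apply: joined_trans h2 (joined_edge e).
have out w : via (top_bot w) -> joined a (mul_ptn b c) p0 (mid_bot w).
  case=> z h1 h2; apply: joined_trans h1 _; apply/joined_edge/EdgeBot.
  exact/same_block_mul.
have inn w : joined a (mul_ptn b c) p0 (mid_bot w) -> via (top_bot w).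
  by move=> h; exists w => //; exact: joined_refl.
have outc w : J (row 0 w) -> joined a (mul_ptn b c) p0 (top_mid w).
  by case: w => x //= h; apply: (out (Upper x)).
have inc w : joined a (mul_ptn b c) p0 (top_mid w) -> J (row 0 w).
  by case: w => x //= h; apply: (inn (Upper x)).
have Ju : J (ends u).
  rewrite /J /p0; case: u @p0 @via @J {ext out inn outc inc} => x /=; first exact: joined_refl.
  by exists (Lower x) => /=; exact: joined_refl.
have Jstep (q q' : nat * X) : edge4 a b c q q' -> J q -> J q'.
  case=> [w z wz|w z wz|w z wz].
  - move/outc=> h; apply: inc; apply: joined_trans h _.
    exact/joined_edge/EdgeTop.
  - by case: w z wz => x [] y wz; exact: (ext _ _ (EdgeTop c wz)).
  - by case: w z wz => x [] y wz; exact: (ext _ _ (EdgeBot b wz)).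
have Jall (q q' : nat * X) : joined4 a b c q q' -> J q -> J q'.
  by elim=> {q q'} [q q' /Jstep|//|q q' q'' _ h _ h' /h /h'].
move/Jall/(_ Ju); case: v => y //= h.
exact: (out (Lower y)).
Qed.

Lemma mulA_ptn : associative mul_ptn.
Proof.
by move=> a b c; apply: ptn_eq => u v; rewrite mul_mulE_l mul_mulE_r.
Qed.

End Product.

HB.instance Definition _ X := isSemigroup.Build (ptn X) (@mulA_ptn X).
HB.instance Definition _ X :=
  Semigroup_isMonoid.Build (ptn X) (@mul1_ptn X) (@mulp1_ptn X).

Definition partition_monoid (X : Type) : monoidType := ptn X.

Section Bergman.
Variable S : semigroupType.
Implicit Types A B : set S.

Definition subsemigroup B := forall x y, B x -> B y -> B (x * y)%g.

Definition generates A := smallest subsemigroup A = [set: S].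

(* Products are of nonempty words, as befits a semigroup: a :: s has
   product (.. (a * s_0) * ..) * s_k. *)
Definition product_of_at_most A (N : nat) (x : S) :=
  exists a s, [/\ [set` a :: s] `<=` A, (size (a :: s) <= N)%N
                & x = foldl *%g a s].

Definition semigroup_bergman :=
  forall A, generates A -> exists N, forall x, product_of_at_most A N x.

End Bergman.

(* Main.v *)
(** A semigroup is Bergman as soon as every sequence [x_0, x_1, ...] can be
    written over a finite set with the length of [x_n] bounded by a function
    of [n] that does not depend on the sequence: a generating set of unbounded
    length would contradict this on a sequence of rapidly growing length.
    In the partition monoid, let [f] and [g] be injections of [X] into itself
    with disjoint images. The maps [e_n = g^n \o f] are injections with
    pairwise disjoint images, so a single partition [s] can carry a copy of
    each [x_n] on the image of [e_n]. Restricting [s] to the image of [e_n]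
    recovers [x_n], and amounts to multiplying [s] on the left by
    [emb f * (emb g)^n] and on the right by the mirror image of this element,
    which makes the length [2 n + 3]. *)

Require Import Defs.
From mathcomp Require Import all_boot.
From mathcomp Require Import boolp classical_sets functions cardinality.
Local Open Scope classical_set_scope.

(** * Word length over generating sets *)

Section ProductLength.
Variable S : semigroupType.
Implicit Types (A B : set S) (x y : S).

Lemma foldl_mulg x y (s : seq S) :
  foldl *%g (x * y)%g s = (x * foldl *%g y s)%g.
Proof. by elim: s y => //= z s IH y; rewrite -mulgA IH. Qed.

Lemma product_of_at_most1 A x : A x -> product_of_at_most A 1 x.
Proof.
by move=> Ax; exists x, [::]; split=> // y /=; rewrite inE => /eqP ->.
Qed.

Lemma product_of_at_mostM A M N x y :
  product_of_at_most A M x -> product_of_at_most A N y ->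
  product_of_at_most A (M + N) (x * y)%g.
Proof.
case=> a [s [asA sM ->]] [b [t [btA tN ->]]]; exists a, (s ++ b :: t); split.
- move=> z /=; rewrite -cat_cons mem_cat => /orP[] zin; [exact: asA|exact: btA].
- by rewrite -cat_cons size_cat leq_add.
- by rewrite foldl_cat /= foldl_mulg.
Qed.

Lemma product_of_at_mostW A M N x : (M <= N)%N ->
  product_of_at_most A M x -> product_of_at_most A N x.
Proof.
by move=> MN [a [s [asA sM ->]]]; exists a, s; split=> //; apply: leq_trans MN.
Qed.

Lemma product_of_at_most_subst A B M N x :
  (forall b, B b -> product_of_at_most A M b) ->
  product_of_at_most B N x -> product_of_at_most A (N * M) x.
Proof.
move=> BA [a [s [asB sN ->]]].
suff: product_of_at_most A (size (a :: s) * M) (foldl *%g a s).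
  by apply: product_of_at_mostW; rewrite leq_mul2r sN orbT.
elim/last_ind: s asB {sN} => [|s b IH] asB.
  by rewrite mul1n; apply/BA/asB; rewrite /= inE.
rewrite foldl_rcons /= size_rcons mulSnr; apply: product_of_at_mostM.
  by apply: IH => z zin; apply: asB; rewrite /= -rcons_cons mem_rcons inE zin orbT.
by apply/BA/asB; rewrite /= -rcons_cons mem_rcons inE eqxx.
Qed.

(** The products of letters of [A] form a subsemigroup containing [A]. *)
Lemma generates_product A x :
  generates A -> exists N, product_of_at_most A N x.
Proof.
move=> genA.
suff: [set: S] `<=` [set y | exists N, product_of_at_most A N y] by apply.
rewrite -genA; apply: smallest_sub => [y z [M yM] [N zN]|y yA]; last first.
  by exists 1; apply: product_of_at_most1.
by exists (M + N)%N; apply: product_of_at_mostM.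
Qed.

Lemma generates_product_seq A (s : seq S) :
  generates A -> exists N, forall x, x \in s -> product_of_at_most A N x.
Proof.
move=> genA; elim: s => [|y s [N sN]]; first by exists 0.
have [M yM] := generates_product A y genA; exists (maxn M N) => x.
rewrite inE => /orP[/eqP ->|/sN].
  exact: product_of_at_mostW (leq_maxl _ _) yM.
exact: product_of_at_mostW (leq_maxr _ _).
Qed.

Lemma strongly_distorted_bergman (l : nat -> nat) :
  (forall x : nat -> S, exists F : seq S,
     forall n, product_of_at_most [set` F] (l n) (x n)) ->
  semigroup_bergman S.
Proof.
move=> distorted A genA; apply: contrapT => /forallNP unbounded.
(* The factor [n] anticipates the length bound [M] over [A] of the finite set [F], known only once
   the sequence is fixed; the contradiction comes at index [M]. *)
have {unbounded} long n : exists x, ~ product_of_at_most A (l n * n) x.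
  exact/existsNP.
have [x xlong] := choice long.
have [F xF] := distorted x.
have [M FM] := generates_product_seq A F genA.
by apply: (xlong M); apply: product_of_at_most_subst (xF M).
Qed.

End ProductLength.

(** * Doubling an infinite set *)

Lemma infinite_disjoint_injections (X : Type) : infinite_set [set: X] ->
  exists f g : X -> X,
    [/\ injective f, injective g & forall x y, f x <> g y].
Proof.
move=> Xinf.
(* [P F] says that the members of [F] are injective with pairwise disjoint
   ranges: up to finitely many points, a maximal such [F] covers [X]. *)
pose P (F : set (nat -> X)) := forall s t, F s -> F t ->
  forall m n, s m = t n -> s = t /\ m = n.
have [F [PF Fmax]] : exists F, P F /\ forall G, F `<` G -> ~ P G.
  apply: Zorn_bigcup => C CP Ctot s t [F CF Fs] [G CG Gt] m n st.
  have [FG|GF] := Ctot _ _ CF CG; first exact: (CP _ CG _ _ (FG _ Fs) Gt _ _ st).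
  exact: (CP _ CF _ _ Fs (GF _ Gt) _ _ st).
pose D := [set x | exists2 s, F s & exists n, x = s n].
have finDC : finite_set (~` D).
  apply: contrapT => /infiniteP/card_leP[u].
  pose s (n : nat) := val (u (SigSub (mem_set (I : [set: nat] n)))).
  have sD (n : nat) : (~` D) (s n) := set_mem (valP (u _)).
  have s_inj : injective s.
    by move=> m n /val_inj /(@inj _ _ _ u) - /(_ (in_setT _) (in_setT _)) /(congr1 val).
  (* The range of [s] avoids [D], so adjoining [s] would properly extend the maximal family. *)
  apply: (Fmax (s |` F)).
    split; first by move=> t Ft; right.
    move=> sF; apply: (sD 0); exists s; last by exists 0.
    by apply: sF; left.
  move=> p q [->|Fp] [->|Fq] m n eq_mn; last exact: PF.
  - by split=> //; apply: s_inj.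
  - by case: (sD m); exists q => //; exists n.
  - by case: (sD n); exists p => //; exists m.
(* Some sequence must host the points outside [D]. Were [F] empty, [D] would be too, and [X] would
   be finite. *)
have [s0 Fs0] : F !=set0.
  apply/set0P/eqP => F0; apply: Xinf.
  suff -> : [set: X] = ~` D by [].
  by apply/seteqP; split=> // x _ [s]; rewrite F0.
have /finite_set_countable/countable_injP[i i_inj] := finDC.
(* [X] is coded injectively into [F * nat], the finite complement of [D] being
   absorbed by the odd indices. *)
have /choice[c cP] : forall x, exists c : (nat -> X) * nat, F c.1 /\
    ((exists n, c.2 = n.*2 /\ x = c.1 n) \/ (~` D) x /\ c = (s0, (i x).*2.+1)).
  move=> x; have [[s Fs [n xn]]|Dx] := pselect (D x).
    by exists (s, n.*2); split=> //; left; exists n.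
  by exists (s0, (i x).*2.+1); split=> //; right.
have c_inj : injective c.
  move=> x y cxy; case: (cP x) (cP y) => _ cx [_ cy]; move: cx cy; rewrite -cxy.
  case=> [[n [n1 n2]]|[Dx n1]] [[m [m1 m2]]|[Dy m1]].
  - by rewrite n2 m2; congr (_ _); apply: double_inj; rewrite -n1.
  - by move: n1; rewrite m1 /= => /(congr1 odd); rewrite /= !odd_double.
  - by move: m1; rewrite n1 /= => /(congr1 odd); rewrite /= !odd_double.
  - move: n1; rewrite m1 => -[/double_inj ixy].
    by apply/esym/i_inj => //; apply: mem_set.
(* Doubling the index once more frees its parity to record [b], giving each point two places. *)
pose d (b : bool) x := (c x).1 ((c x).2.*2 + b).
have d_inj b b' x y : d b x = d b' y -> b = b' /\ x = y.
  move=> /(PF _ _ (cP x).1 (cP y).1)[e1 e2].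
  have bb : b = b'.
    by have := congr1 odd e2; rewrite !oddD !odd_double !oddb.
  split=> //; apply: c_inj; move: e2; rewrite bb => /addIn/double_inj e2.
  by case: (c x) (c y) e1 e2 => ? ? [? ?] /= -> ->.
exists (d false), (d true); split=> [x y|x y|x y].
- by case/d_inj.
- by case/d_inj.
- by case/d_inj.
Qed.

(** * Pullbacks of partitions *)

Section Comap.
Variable X : Type.
Implicit Types (a b : ptn X) (u v : vertex X).
Implicit Types (h : vertex X -> vertex X) (f g : X -> X).

Lemma comapP h a :
  partition (classes (fun u v => same_block a (h u) (h v))) id [set: vertex X].
Proof.
apply: classesP => *; [exact: same_block_refl|exact: same_block_sym|].
by apply: same_block_trans; eauto.
Qed.

Definition comap h a : ptn X := Ptn (comapP h a).

Lemma same_block_comap h a u v :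
  same_block (comap h a) u v <-> same_block a (h u) (h v).
Proof.
apply: (@same_block_classes _ _ (fun u v => same_block a (h u) (h v))) => //.
- by move=> *; exact: same_block_refl.
- by move=> *; exact: same_block_sym.
- by move=> *; apply: same_block_trans; eauto.
Qed.

Definition on_upper f u := if u is Upper x then Upper (f x) else u.
Definition on_lower f u := if u is Lower x then Lower (f x) else u.
Definition on_both f u :=
  match u with Upper x => Upper (f x) | Lower x => Lower (f x) end.

(* For injective [f], the nontrivial blocks of [emb f] are the [{x, (f x)'}],
   and those of [proj f] are the [{f x, x'}]. *)
Definition emb f := comap (on_upper f) (one_ptn X).
Definition proj f := comap (on_lower f) (one_ptn X).

(** In the product graph [Top x] is joined to [Mid (f x)]. The map [k] contracts all edges of
    [emb f], so a path becomes a chain inside one block of [a]. *)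
Lemma mul_emb f a : mul_ptn (emb f) a = comap (on_upper f) a.
Proof.
apply: ptn_eq => u v; rewrite same_block_mul same_block_comap; split.
  pose k p :=
    match p with Top x => Upper (f x) | Mid x => Upper x | Bot x => Lower x end.
  have kj p q : joined (emb f) a p q -> same_block a (k p) (k q).
    elim=> {p q} [p q [w z /same_block_comap/same_block_one|w z]|p|p q r _ pq _ qr].
    - by case: w => x; case: z => y /= ->; exact: same_block_refl.
    - by case: w => x; case: z => y.
    - exact: same_block_refl.
    - exact: same_block_trans pq qr.
  by move/kj; case: u => x; case: v => y.
have j w : joined (emb f) a (top_bot w) (mid_bot (on_upper f w)).
  case: w => x /=; last exact: joined_refl.
  apply/joined_edge/(@EdgeTop _ _ _ (Upper x) (Lower (f x))).
  exact/same_block_comap/same_block_one.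
move=> uv; apply: joined_trans (j u) (joined_trans _ (joined_sym (j v))).
exact/joined_edge/EdgeBot.
Qed.

Lemma mul_proj f a : mul_ptn a (proj f) = comap (on_lower f) a.
Proof.
apply: ptn_eq => u v; rewrite same_block_mul same_block_comap; split.
  pose k p :=
    match p with Top x => Upper x | Mid x => Lower x | Bot x => Lower (f x) end.
  have kj p q : joined a (proj f) p q -> same_block a (k p) (k q).
    elim=> {p q} [p q [w z|w z /same_block_comap/same_block_one]|p|p q r _ pq _ qr].
    - by case: w => x; case: z => y.
    - by case: w => x; case: z => y /= ->; exact: same_block_refl.
    - exact: same_block_refl.
    - exact: same_block_trans pq qr.
  by move/kj; case: u => x; case: v => y.
have j w : joined a (proj f) (top_bot w) (top_mid (on_lower f w)).
  case: w => x /=; first exact: joined_refl.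
  apply/joined_edge/(@EdgeBot _ _ _ (Lower x) (Upper (f x))).
  exact/same_block_comap/same_block_one.
move=> uv; apply: joined_trans (j u) (joined_trans _ (joined_sym (j v))).
exact/joined_edge/EdgeTop.
Qed.

Lemma mul_emb_proj f a :
  mul_ptn (mul_ptn (emb f) a) (proj f) = comap (on_both f) a.
Proof.
rewrite mul_proj mul_emb; apply: ptn_eq => u v; rewrite !same_block_comap.
by case: u => x; case: v => y.
Qed.

Lemma same_block_iter_comap h n a u v :
  same_block (iter n (comap h) a) u v <-> same_block a (iter n h u) (iter n h v).
Proof. by elim: n u v => // n IH u v; rewrite same_block_comap IH -!iterSr. Qed.

Section DisjointUnion.
Variables (e : nat -> X -> X) (a : nat -> ptn X).
Hypothesis e_inj : forall m n x y, e m x = e n y -> m = n /\ x = y.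

(** The first alternative turns every vertex outside the images of the [e n] into a singleton
    block. *)
Definition disjoint_union_rel u v := u = v \/
  exists n u' v', [/\ u = on_both (e n) u', v = on_both (e n) v'
                    & same_block (a n) u' v'].

Lemma on_both_inj m n u v :
  on_both (e m) u = on_both (e n) v -> m = n /\ u = v.
Proof. by case: u => x; case: v => y //= -[/e_inj[-> ->]]. Qed.

Lemma disjoint_union_rel_refl u : disjoint_union_rel u u.
Proof. by left. Qed.

Lemma disjoint_union_rel_sym u v :
  disjoint_union_rel u v -> disjoint_union_rel v u.
Proof.
case=> [->|[n [u' [v' [-> -> uv]]]]]; first by left.
by right; exists n, v', u'; split=> //; exact: same_block_sym.
Qed.

Lemma disjoint_union_rel_trans u v w :
  disjoint_union_rel u v -> disjoint_union_rel v w -> disjoint_union_rel u w.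
Proof.
case=> [->//|[n [u' [v' [-> -> uv]]]]] [<-|[m [v2 [w' [+ -> vw]]]]].
  by right; exists n, u', v'.
move/on_both_inj => [nm vv]; subst m v2.
by right; exists n, u', w'; split=> //; apply: same_block_trans uv vw.
Qed.

Definition disjoint_union : ptn X :=
  Ptn (classesP disjoint_union_rel_refl disjoint_union_rel_sym
                disjoint_union_rel_trans).

Lemma same_block_disjoint_union n u v :
  same_block disjoint_union (on_both (e n) u) (on_both (e n) v) <->
  same_block (a n) u v.
Proof.
rewrite (same_block_classes disjoint_union_rel_refl disjoint_union_rel_sym
  disjoint_union_rel_trans) //; split.
  case=> [/on_both_inj[_ ->]|]; first exact: same_block_refl.
  by move=> [m [u' [v' [/on_both_inj[<- <-] /on_both_inj[_ <-]]]]].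
by move=> uv; right; exists n, u, v.
Qed.

End DisjointUnion.

(** * Coding a sequence in one partition *)

Lemma sequence_of_linear_length f g (a : nat -> partition_monoid X) :
    injective f -> injective g -> (forall x y, f x <> g y) ->
  exists F : seq (partition_monoid X),
    forall n, product_of_at_most [set` F] (n.*2 + 3) (a n).
Proof.
move=> f_inj g_inj fg.
pose e n x := iter n g (f x).
have e_inj m n x y : e m x = e n y -> m = n /\ x = y.
  rewrite /e; elim: m n => [|m IH] [|n] /=.
  - by move/f_inj.
  - by move/fg.
  - by move/esym/fg.
  - by move=> /g_inj/IH[-> ->].
pose s : partition_monoid X := disjoint_union e a e_inj.
pose F : seq (partition_monoid X) := [:: s; emb f; proj f; emb g; proj g].
exists F => n.
have gen x : x \in F -> product_of_at_most [set` F] 1 x.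
  exact: product_of_at_most1.
(* Each pullback along [g] costs one factor on either side; the final pullback along [f] adds the
   last two. *)
have iter_s : product_of_at_most [set` F] (n.*2 + 1) (iter n (comap (on_both g)) s).
  elim: n => [|n IH]; first by apply: gen; rewrite !inE eqxx.
  rewrite iterS -mul_emb_proj.
  have -> : (n.+1.*2 + 1 = 1 + (n.*2 + 1) + 1)%N by rewrite doubleS !addn1 add1n.
  by apply: product_of_at_mostM; [apply: product_of_at_mostM => //|];
    apply: gen; rewrite !inE eqxx ?orbT.
have -> : a n = mul_ptn (mul_ptn (emb f) (iter n (comap (on_both g)) s)) (proj f).
  rewrite mul_emb_proj; apply: ptn_eq => u v.
  rewrite same_block_comap same_block_iter_comap.
  (* Pullback reverses composition: [f] acts first on vertices, hence its factors are outermost. *)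
  have eE w : iter n (on_both g) (on_both f w) = on_both (e n) w.
    by rewrite /e; elim: n {iter_s} => [|n /= ->]; case: w.
  by rewrite !eE; apply: iff_sym; apply: same_block_disjoint_union.
have -> : (n.*2 + 3 = 1 + (n.*2 + 1) + 1)%N by rewrite addnCA -addnA.
by apply: product_of_at_mostM; [apply: product_of_at_mostM => //|];
  apply: gen; rewrite !inE eqxx ?orbT.
Qed.

End Comap.

Theorem theorem41 (X : Type) (X_infinite : infinite_set [set: X]) :
  semigroup_bergman (partition_monoid X).
Proof.
have [f [g [f_inj g_inj fg]]] := infinite_disjoint_injections X X_infinite.
apply: (@strongly_distorted_bergman _ (fun n => n.*2 + 3)) => a.
exact: sequence_of_linear_length f_inj g_inj fg.
Qed.
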